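(* Let $\Omega_j\in\mathbb{R}$ with $\sum_{j=1}^N\Omega_j=0$, and let $z_{jk}$, $j,k=1,\dots,N$, be solutions of the correlation system $$\frac{d}{dt}z_{jk}=i(\Omega_j-\Omega_k)z_{jk}+\frac{\kappa}{2N}\sum_{l=1}^N(z_{jl}+z_{lk})(1-z_{jk}).$$ Suppose $\kappa>\Big(2\sqrt{\tfrac{11+8\sqrt2}{7}}\Big)\max_j|\Omega_j|$, let $\alpha_j$ be the angles of a phase-locked state (see context) with all $\alpha_j\in(-\frac\pi2,\frac\pi2)$, and suppose that the initial data satisfy $$4N(M_1+M_2)-2M_1<C_1(\kappa),\qquad M_1=\sup_{j,k}|f_{jk}(0)|,\quad M_2=\sup_{j,k}|g_{jk}(0)|,$$ where $C_1(\kappa)>0$ is the constant given in the context. Then the system of correlations converges exponentially fast to the phase-locked state $z^\infty_{jk}=e^{i(\alpha_j-\alpha_k)}$, and the rate of convergence is given by the Grönwall inequality $$\frac{d}{dt}\mathcal{L}\le -C_2\,\mathcal{L}\quad\text{for all }t\ge0,$$ for a constant $C_2=C_2(\kappa,N,M_1,M_2)>0$.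
   Context: $N\ge2$, $\kappa>0$. The $z_{jk}$ are correlations $z_{jk}=\langle\psi_j,\psi_k\rangle$ of unit vectors in $L^2(\mathbb{R}^d)$, so $z_{jj}=1$, $z_{kj}=\overline{z_{jk}}$, $|z_{jk}|\le1$; write $r_{jk}=\mathrm{Re}\,z_{jk}$, $s_{jk}=\mathrm{Im}\,z_{jk}$. Phase-locked state: angles $\alpha_j\in[-\pi,\pi)$ and $\lambda_\infty\in(0,1]$ satisfying $\lambda_\infty\sin\alpha_j=\Omega_j/\kappa$, $\lambda_\infty=\frac1N\sum_l\cos\alpha_l$, $\frac1N\sum_l\sin\alpha_l=0$; then $z_{jk}^\infty=e^{i(\alpha_j-\alpha_k)}$, $r_{jk}^\infty=\cos(\alpha_j-\alpha_k)$, $s_{jk}^\infty=\sin(\alpha_j-\alpha_k)$. $f_{jk}=r_{jk}^\infty-r_{jk}$, $g_{jk}=s_{jk}^\infty-s_{jk}$, and $\mathcal{L}=\frac{1}{2N^2}\sum_{j,k=1}^N(f_{jk}^2+g_{jk}^2)$. Constant $C_1$: let $A>2\sqrt{\frac{11+8\sqrt2}{7}}$ be such that $\kappa\ge A\max_j|\Omega_j|$, set $B=\frac{1}{A^2\left(1+\sqrt{1-4/A^2}\right)}$ and $C_1(\kappa)=C_B=2(1-4\sqrt B-4B)$, which is positive.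
   Formalization: The formal theorem adds the hypothesis $\lambda_\infty^2\ge 1/2$, which selects the stable phase-locked state; without it the claim fails, e.g. for N=2, κ=1, Ω=(0.14,−0.14), $\lambda_\infty=\sqrt{0.02}$, and every excluded state is linearly unstable. *)

(* Defs.v *)
From mathcomp Require Import all_boot all_order all_algebra.
From mathcomp Require Import all_classical all_reals all_analysis.
From mathcomp Require Import complex.

Set Implicit Arguments.
Unset Strict Implicit.
Unset Printing Implicit Defensive.

Import Order.TTheory GRing.Theory Num.Theory.
Import numFieldNormedType.Exports.

Local Open Scope classical_set_scope.
Local Open Scope ring_scope.
Local Open Scope complex_scope.

(* Time derivative on the half-line [0, +oo[: the increment h is restricted to
   t + h >= 0, so this is the usual derivative for t > 0 and the right
   derivative for t = 0. *)
Definition has_deriv_ge0 (R : realType) (f : R -> R) (t l : R) : Prop :=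
  (f (t + h) - f t) / h @[h --> within [set h | 0 <= t + h] 0^'] --> l.

(* Derivative of a complex-valued function of real time, componentwise. *)
Definition has_cderiv_ge0 (R : realType) (z : R -> R[i]) (t : R) (l : R[i]) :
    Prop :=
  has_deriv_ge0 (fun s => complex.Re (z s)) t (complex.Re l) /\
  has_deriv_ge0 (fun s => complex.Im (z s)) t (complex.Im l).

Section Correlations.
Variables (R : realType) (N : nat).
Implicit Types (kappa lambda : R) (Omega alpha : 'I_N -> R).
Implicit Types (z : 'I_N -> 'I_N -> R -> R[i]).

(* The properties of z_jk(t) = <psi_j(t), psi_k(t)>, with unit vectors psi_j. *)
Definition is_correlation z : Prop :=
  forall t, 0 <= t ->
  [/\ forall j, z j j t = 1,
      forall j k, z k j t = (z j k t)^*
    & forall j k, `|z j k t| <= 1].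

Definition correlation_rhs kappa Omega z (j k : 'I_N) (t : R) : R[i] :=
  'i%C * (Omega j - Omega k)%:C * z j k t +
  (kappa / (2 * N%:R))%:C *
    \sum_(l < N) (z j l t + z l k t) * (1 - z j k t).

Definition correlation_system kappa Omega z : Prop :=
  forall j k t, 0 <= t ->
    has_cderiv_ge0 (z j k) t (correlation_rhs kappa Omega z j k t).

Definition phase_locked kappa Omega alpha lambda : Prop :=
  [/\ forall j, - pi <= alpha j < pi,
      0 < lambda <= 1,
      forall j, lambda * sin (alpha j) = Omega j / kappa,
      lambda = N%:R^-1 * \sum_(l < N) cos (alpha l)
    & N%:R^-1 * \sum_(l < N) sin (alpha l) = 0].

(* exp (i (alpha_j - alpha_k)) *)
Definition zinf alpha (j k : 'I_N) : R[i] :=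
  cos (alpha j - alpha k) +i* sin (alpha j - alpha k).

Definition fdiff alpha z (j k : 'I_N) (t : R) : R :=
  complex.Re (zinf alpha j k) - complex.Re (z j k t).

Definition gdiff alpha z (j k : 'I_N) (t : R) : R :=
  complex.Im (zinf alpha j k) - complex.Im (z j k t).

Definition lyapunov alpha z (t : R) : R :=
  (2 * N%:R ^+ 2)^-1 *
  \sum_(j < N) \sum_(k < N) (fdiff alpha z j k t ^+ 2 + gdiff alpha z j k t ^+ 2).

(* The default value 0 of the iterated maxima is harmless: all the terms are
   nonnegative. *)
Definition max_freq Omega : R := \big[Num.max/0]_(j < N) `|Omega j|.

Definition supf0 alpha z : R :=
  \big[Num.max/0]_(p : 'I_N * 'I_N) `|fdiff alpha z p.1 p.2 0|.

Definition supg0 alpha z : R :=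
  \big[Num.max/0]_(p : 'I_N * 'I_N) `|gdiff alpha z p.1 p.2 0|.

Definition converges_exponentially z (w : 'I_N -> 'I_N -> R[i]) : Prop :=
  exists K c : R, [/\ 0 < K, 0 < c &
    forall j k t, 0 <= t -> `|z j k t - w j k| <= (K * expR (- c * t))%:C].

End Correlations.

Definition A_min (R : realType) : R :=
  2 * Num.sqrt ((11 + 8 * Num.sqrt 2) / 7).

Definition B_of (R : realType) (A : R) : R :=
  (A ^+ 2 * (1 + Num.sqrt (1 - 4 / A ^+ 2)))^-1.

Definition C1_of (R : realType) (A : R) : R :=
  2 * (1 - 4 * Num.sqrt (B_of A) - 4 * B_of A).

(* Main.v *)
(* Write w = zinf - z = f + i g and E = \sum_(j, k) |w_jk|^2 = 2 N^2 L.  Since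
   zinf is stationary, w solves
     w' = i (Omega_j - Omega_k) w - kappa/(2N) (Z w - W (1 - zinf) - W w),
   with Z_jk = N lambda (exp (i alpha_j) + exp (- i alpha_k)) and
   W_jk = \sum_l (w_jl + w_lk).  In E', the rotation and the imaginary part of Z
   drop out, the real part of Z dissipates at rate lambda cos alpha_j >= 1 - 2B,
   the term linear in W costs at most sup |1 - zinf| <= 4 sqrt B, and the cubic
   term costs at most m as long as E <= m^2; hence
     E' <= - 2 kappa (1 - 2B - 4 sqrt B - m) E <= - kappa (C1 - 2m) E.
   Initially E <= (N (M1 + M2))^2 < (C1 / 2)^2, so E can never reach (C1 / 2)^2:
   it is nonincreasing, and the estimate holds for all times with
   m = N (M1 + M2). *)
Require Import Defs.
From mathcomp Require Import all_boot all_order all_algebra.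
From mathcomp Require Import all_classical all_reals all_analysis.
From mathcomp Require Import complex ring lra.

Set Implicit Arguments.
Unset Strict Implicit.
Unset Printing Implicit Defensive.

Import Order.TTheory GRing.Theory Num.Theory.
Import numFieldNormedType.Exports.

Local Open Scope ring_scope.
Local Open Scope complex_scope.

(** * Calculus on the half-line *)

Section HalfLine.
Local Open Scope classical_set_scope.
Variable R : realType.
Implicit Types (f g : R -> R) (t l : R).

(** Every [x > t] gives an admissible nonzero increment [x - t], so a limit over increments
    restricts to a limit from the right, even at [t = 0]. *)
Lemma within_increments_at_right t : 0 <= t ->
  (x - t) @[x --> t^'+] --> within [set h | 0 <= t + h] 0^'.
Proof.
move=> t0 U /nbhs_ballP[e /= e0 HU].
suff : \forall x \near t^'+, U (x - t) by [].
near=> x; apply: HU => /=.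
- rewrite -ball_normE /= sub0r normrN gtr0_norm ?subr_gt0//.
  by rewrite ltrBlDl; near: x; apply: nbhs_right_lt; rewrite ltrDl.
- by rewrite subr_eq0 gt_eqF.
- by rewrite addrC subrK (le_trans t0)// ltW.
Unshelve. all: by end_near. Qed.

Lemma has_deriv_ge0_continuous f t l : has_deriv_ge0 f t l ->
  f (t + h) @[h --> within [set h | 0 <= t + h] 0^'] --> f t.
Proof.
move=> fl.
have H : (f (t + h) - f t) / h * h + f t
    @[h --> within [set h | 0 <= t + h] 0^'] --> l * 0 + f t.
  apply: cvgD; last exact: cvg_cst.
  apply: cvgM => //; apply: cvg_within_filter; exact: cvg_within.
rewrite mulr0 add0r in H; apply: cvg_trans H; apply: near_eq_cvg.
near=> h; rewrite divfK ?subrK//; near: h.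
suff : \forall h \near (0 : R)^', h != 0 by apply: cvg_within.
exact: nbhs_dnbhs_neq.
Unshelve. all: by end_near. Qed.

Lemma has_deriv_ge0_right_continuous f t l : 0 <= t -> has_deriv_ge0 f t l ->
  f @ t^'+ --> f t.
Proof.
move=> t0 /has_deriv_ge0_continuous H.
have := cvg_comp _ _ (within_increments_at_right t0) H.
by apply: cvg_trans; apply: near_eq_cvg; near=> x; rewrite /= addrC subrK.
Unshelve. all: by end_near. Qed.

(** For [t > 0] every increment with [|h| < t] is admissible, so near 0 the restriction to the
    half-line disappears. *)
Lemma has_deriv_ge0_is_derive f t l : 0 < t -> has_deriv_ge0 f t l ->
  is_derive t 1 f l.
Proof.
move=> t0 fl.
have H : h^-1 *: ((f \o shift t) (h *: 1) - f t) @[h --> 0^'] --> l.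
  move=> U /fl; rewrite /within /= => HU.
  suff : \forall h \near 0^', U (h^-1 *: (f (h *: 1 + t) - f t)) by [].
  near=> h; rewrite /GRing.scale /= mulr1 mulrC (addrC h).
  have : 0 <= t + h -> U ((f (t + h) - f t) / h) by near: h.
  apply; rewrite -lerBlDl sub0r lerNl.
  have : `|h| < t by near: h; apply: dnbhs0_lt.
  by rewrite ltr_norml => /andP[? _]; lra.
split; first by apply/cvg_ex; exists l.
exact: cvg_lim H.
Unshelve. all: by end_near. Qed.

Lemma is_derive_has_deriv_ge0 f t l : is_derive t 1 f l -> has_deriv_ge0 f t l.
Proof.
move=> [/[swap] <- fl]; apply: cvg_within_filter; apply: cvg_trans fl.
apply: near_eq_cvg; near=> h.
by rewrite /= /GRing.scale /= mulr1 mulrC (addrC h).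
Unshelve. all: by end_near. Qed.

Lemma has_deriv_ge0_cst c t : has_deriv_ge0 (fun=> c) t 0.
Proof. exact: is_derive_has_deriv_ge0. Qed.

Lemma has_deriv_ge0D f g t l m : has_deriv_ge0 f t l -> has_deriv_ge0 g t m ->
  has_deriv_ge0 (fun x => f x + g x) t (l + m).
Proof.
move=> fl gm; apply: cvg_trans (cvgD fl gm); apply: near_eq_cvg; near=> h.
by rewrite fctE; ring.
Unshelve. all: by end_near. Qed.

Lemma has_deriv_ge0M f g t l m : has_deriv_ge0 f t l -> has_deriv_ge0 g t m ->
  has_deriv_ge0 (fun x => f x * g x) t (l * g t + f t * m).
Proof.
move=> fl gm; have gc := has_deriv_ge0_continuous gm.
have H : (f (t + h) - f t) / h * g (t + h) + f t * ((g (t + h) - g t) / h)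
    @[h --> within [set h | 0 <= t + h] 0^'] --> l * g t + f t * m.
  by apply: cvgD; apply: cvgM => //; exact: cvg_cst.
by apply: cvg_trans H; apply: near_eq_cvg; near=> h; ring.
Unshelve. all: by end_near. Qed.

Lemma has_deriv_ge0_sum (I : Type) (r : seq I) (F : I -> R -> R) (dF : I -> R) t :
  (forall i, has_deriv_ge0 (F i) t (dF i)) ->
  has_deriv_ge0 (fun x => \sum_(i <- r) F i x) t (\sum_(i <- r) dF i).
Proof.
move=> FdF; elim: r => [|i r IH].
  rewrite big_nil (_ : (fun _ => _) = fun=> 0); first exact: has_deriv_ge0_cst.
  by apply/funext => x; rewrite big_nil.
rewrite big_cons (_ : (fun _ => _) = fun x => F i x + \sum_(i <- r) F i x).
  exact: has_deriv_ge0D.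
by apply/funext => x; rewrite big_cons.
Qed.

(** Two-sided derivatives exist on the open interval, and right continuity suffices at [a], which
    may be 0. *)
Lemma MVT_ge0 f (df : R -> R) a b : 0 <= a -> a < b ->
  (forall x, 0 <= x -> has_deriv_ge0 f x (df x)) ->
  exists2 c, a < c < b & f b - f a = df c * (b - a).
Proof.
move=> a0 ab fdf.
have D x : a < x -> is_derive x 1 f (df x).
  move=> ax; apply: has_deriv_ge0_is_derive; first exact: le_lt_trans ax.
  by apply: fdf; rewrite (le_trans a0)// ltW.
have C x : a < x -> {for x, continuous f}.
  by move=> /D [/derivable1_diffP/differentiable_continuous].
have [||c] := @MVT R f df a b ab.
- by move=> x; rewrite in_itv/= => /andP[/D].
- apply/continuous_within_itvP => //; split.
  + by move=> x; rewrite in_itv/= => /andP[/C].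
  + exact: has_deriv_ge0_right_continuous (fdf _ a0).
  + by apply: cvg_at_left_filter; exact: C.
- by rewrite in_itv/= => cab E; exists c.
Qed.

Lemma has_deriv_ge0_nonincreasing f (df : R -> R) a b : 0 <= a <= b ->
  (forall x, 0 <= x -> has_deriv_ge0 f x (df x)) ->
  (forall x, a < x < b -> df x <= 0) -> f b <= f a.
Proof.
move=> /andP[a0]; rewrite le_eqVlt => /predU1P[->//|ab] fdf df0.
have [c cab E] := MVT_ge0 a0 ab fdf.
by rewrite -subr_le0 E mulr_le0_ge0 ?df0// subr_ge0 ltW.
Qed.

(** The integrating factor [expR (c * x)] turns the differential inequality into monotonicity of
    [f x * expR (c * x)]. *)
Lemma gronwall_ge0 f (df : R -> R) c :
  (forall x, 0 <= x -> has_deriv_ge0 f x (df x)) ->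
  (forall x, 0 <= x -> df x <= - c * f x) ->
  forall t, 0 <= t -> f t <= f 0 * expR (- c * t).
Proof.
move=> fdf dfc t t0.
pose g x := f x * expR (c * x).
have gdg x : 0 <= x ->
    has_deriv_ge0 g x (df x * expR (c * x) + f x * (c * expR (c * x))).
  move=> x0; apply: has_deriv_ge0M; first exact: fdf.
  apply: is_derive_has_deriv_ge0; rewrite mulrC.
  apply: (@is_derive1_comp R expR (fun y => c * y)).
  have := is_deriveZ (f := @id R) c (is_derive_id x (1 : R)).
  by rewrite /GRing.scale /= mulr1.
have : g t <= g 0.
  apply: has_deriv_ge0_nonincreasing gdg _; first by rewrite lexx.
  move=> x /andP[/ltW x0 _].
  have -> : df x * expR (c * x) + f x * (c * expR (c * x)) =
    (df x - (- c * f x)) * expR (c * x) by ring.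
  by rewrite mulr_le0_ge0 ?expR_ge0// subr_le0 dfc.
rewrite /g mulr0 expR0 mulr1 => H.
by rewrite mulNr expRN ler_pdivlMr ?expR_gt0.
Qed.

(** Continuity argument: the sign of [df] is known only while [f <= c], but until the first time at
    level [c] this makes [f] nonincreasing, so that [f] stays below [f 0 < c]. *)
Lemma barrier_ge0 f (df : R -> R) c :
  (forall x, 0 <= x -> has_deriv_ge0 f x (df x)) ->
  (forall x, 0 <= x -> f x <= c -> df x <= 0) ->
  f 0 < c -> forall t, 0 <= t -> f t < c.
Proof.
move=> fdf df0 f0c t t0; rewrite ltNge; apply/negP => ct.
pose S := [set x | 0 <= x /\ c <= f x].
have S0 : S !=set0 by exists t.
have lbS : lbound S 0 by move=> x [].
have hS : has_inf S by split => //; exists 0.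
(* the first time at which f reaches c *)
pose s := inf S.
have s0 : 0 <= s by apply: lb_le_inf.
have below x : 0 <= x -> x < s -> f x < c.
  move=> x0 xs; rewrite ltNge; apply/negP => cx.
  by have := ge_inf hS.2 (conj x0 cx : S x); rewrite leNgt xs.
have fs : f s < c.
  apply: le_lt_trans f0c.
  apply: (@has_deriv_ge0_nonincreasing f df 0 s) => //; first by rewrite lexx.
  by move=> x /andP[/ltW x0 xs]; apply: df0 => //; exact/ltW/below.
have /nbhs_ballP[e /= e0 He] :
    \forall x \near s^'+, f x < c.
  exact: cvgr_lt (has_deriv_ge0_right_continuous s0 (fdf _ s0)) _ fs.
(* Right continuity keeps [f] below [c] slightly beyond [s], so a larger number than the infimum
   would bound [S] from below. *)
have : s + e <= s.
  apply: lb_le_inf => // x [x0 cx]; rewrite leNgt; apply/negP => xse.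
  have : s <= x := ge_inf hS.2 (conj x0 cx : S x).
  rewrite le_eqVlt => /predU1P[sx|sx]; first by move: cx; rewrite -sx leNgt fs.
  have := He x; rewrite -ball_normE /= ltr0_norm ?subr_lt0// opprB ltrBlDl.
  by move=> /(_ xse sx); rewrite ltNge cx.
by rewrite -subr_ge0 opprD addNKr oppr_ge0 leNgt e0.
Qed.
End HalfLine.

(** * Estimates on the phase-locked state *)

Section PhaseLocked.
Variables (R : realType) (A : R).
Hypothesis hA : A_min R < A.

(** In this parameter the constants become polynomial: A^-2 = (1 - u^2)/4 and B = (1 - u)/4. *)
Let u : R := Num.sqrt (1 - 4 / A ^+ 2).

Let A_gt0 : 0 < A.
Proof. by apply: le_lt_trans hA; rewrite mulr_ge0// sqrtr_ge0. Qed.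

Let A_sqr_gt : 4 * (11 + 8 * Num.sqrt 2) / 7 < A ^+ 2.
Proof.
have m0 : 0 <= A_min R by rewrite mulr_ge0// sqrtr_ge0.
have s2 : 0 <= Num.sqrt 2 :> R := sqrtr_ge0 _.
have : A_min R ^+ 2 < A ^+ 2 by rewrite ltr_pXn2r// nnegrE// ltW.
rewrite /A_min exprMn sqr_sqrtr; first by lra.
by apply: divr_ge0; lra.
Qed.

Let sqr_u : u ^+ 2 = 1 - 4 / A ^+ 2.
Proof.
rewrite sqr_sqrtr// subr_ge0 ler_pdivrMr ?exprn_gt0// mul1r.
have s2 : 0 <= Num.sqrt 2 :> R := sqrtr_ge0 _.
by have := A_sqr_gt; lra.
Qed.

Let invr_sqrA : A ^- 2 = (1 - u ^+ 2) / 4.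
Proof. by rewrite sqr_u; field; rewrite gt_eqF. Qed.

(** The lower bound is exactly the condition for C1 > 0, and is what the threshold [A_min]
    encodes. *)
Let u_bounds : 2 * Num.sqrt 2 - 2 < u < 1.
Proof.
have r0 : 0 <= Num.sqrt 2 :> R := sqrtr_ge0 _.
have r2 : Num.sqrt 2 ^+ 2 = 2 :> R by rewrite sqr_sqrtr.
have u0 : 0 <= u := sqrtr_ge0 _.
have i0 : 0 < A ^- 2 by rewrite invr_gt0 exprn_gt0.
have u1 : u < 1 by rewrite invr_sqrA in i0; nra.
rewrite u1 andbT.
(* The left side is (2 sqrt 2 - 2)^2. As (11 + 8 sqrt 2)(8 sqrt 2 - 11) = 7, the bound on A^2 reads
   4/A^2 < 8 sqrt 2 - 11. *)
have : (12 - 8 * Num.sqrt 2) < u ^+ 2.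
  rewrite -(ltr_pM2l (_ : 0 < 4 * (11 + 8 * Num.sqrt 2))); last by lra.
  have : (4 * (11 + 8 * Num.sqrt 2)) / A ^+ 2 < 7.
    by rewrite ltr_pdivrMr ?exprn_gt0//; have := A_sqr_gt; lra.
  by rewrite invr_sqrA; nra.
by move=> H; nra.
Qed.

Lemma B_ofE : B_of A = (1 - u) / 4.
Proof.
have [ul u1] := andP u_bounds; rewrite /B_of -/u invfM.
have r0 : 0 <= Num.sqrt 2 :> R := sqrtr_ge0 _.
have u0 : 0 <= u := sqrtr_ge0 _.
have un : 1 + u != 0 by apply/negP => /eqP; lra.
by rewrite invr_sqrA; field.
Qed.

Lemma B_of_gt0 : 0 < B_of A.
Proof. by have [_ u1] := andP u_bounds; rewrite B_ofE; lra. Qed.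

(** With b = sqrt B, C1 / 2 = 2 - (1 + 2b)^2, so it suffices that 2b < sqrt 2 - 1; squared, this is
    the lower bound on [u]. *)
Lemma C1_of_gt0 : 0 < C1_of A.
Proof.
have [ul u1] := andP u_bounds; rewrite /C1_of.
have := sqr_sqrtr (ltW B_of_gt0); have := sqrtr_ge0 (B_of A).
set b := Num.sqrt _ => b0; rewrite B_ofE => bE.
have r0 : 0 <= Num.sqrt 2 :> R := sqrtr_ge0 _.
have r2 : Num.sqrt 2 ^+ 2 = 2 :> R by rewrite sqr_sqrtr.
have r1 : 1 <= Num.sqrt 2 :> R by nra.
have : 2 * b < Num.sqrt 2 - 1.
  by rewrite -(ltr_pXn2r (ltn0Sn 1)) ?nnegrE ?subr_ge0 ?mulr_ge0//; nra.
by nra.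
Qed.

(** * Angles and order parameter on the stable branch *)

Section State.
Variables (N : nat) (kappa lambda : R) (Omega alpha : 'I_N -> R).
Hypotheses (kappa_gt0 : 0 < kappa) (hfreq : A * max_freq Omega <= kappa).
Hypothesis hlocked : phase_locked kappa Omega alpha lambda.
Hypothesis halpha : forall j, - (pi / 2) < alpha j < pi / 2.
Hypothesis hlambda : 1 / 2 <= lambda ^+ 2.

Let lambda_gt0 : 0 < lambda.
Proof. by case: hlocked => _ /andP[]. Qed.

Let cos_alpha_gt0 j : 0 < cos (alpha j).
Proof. exact: cos_gt0_pihalf. Qed.

Let sqr_lambda_sin j : (lambda * sin (alpha j)) ^+ 2 <= A ^- 2.
Proof.
case: hlocked => _ _ -> _ _.
have Oj : `|Omega j| <= max_freq Omega by exact: le_bigmax.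
rewrite -exprVn -(real_normK (num_real (_ / _))) lerXn2r
  ?nnegrE ?invr_ge0 ?(ltW A_gt0)//.
rewrite normrM normfV (gtr0_norm kappa_gt0) ler_pdivrMr// ler_pdivlMl//.
by apply: le_trans hfreq; rewrite ler_pM2l.
Qed.

(* Averaging lambda cos alpha_j >= sqrt (lambda^2 - A^-2) over j gives
   lambda^4 - lambda^2 + A^-2 >= 0, and lambda^2 >= 1/2 selects the upper root. *)
Let sqr_lambda_ge : (1 + u) / 2 <= lambda ^+ 2.
Proof.
have u0 : 0 <= u := sqrtr_ge0 _.
have d0 : 0 <= lambda ^+ 2 - A ^- 2.
  by rewrite invr_sqrA; have := sqr_ge0 u; have := hlambda; lra.
have l2 : Num.sqrt (lambda ^+ 2 - A ^- 2) <= lambda ^+ 2.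
  have lcos i : Num.sqrt (lambda ^+ 2 - A ^- 2) <= lambda * cos (alpha i).
    have c0 := ltW (mulr_gt0 lambda_gt0 (cos_alpha_gt0 i)).
    rewrite -(ler_pXn2r (ltn0Sn 1)) ?nnegrE ?sqrtr_ge0// sqr_sqrtr//.
    have := sqr_lambda_sin i; rewrite !exprMn sin2cos2.
    by move: (cos _) => c; lra.
  case: hlocked => _ _ _ lE _.
  have N0 : (0 : R) < N%:R.
    rewrite ltr0n lt0n; apply/eqP => N0.
    have iN0 : N%:R^-1 = 0 :> R by rewrite N0 invr0.
    by move: lambda_gt0; rewrite lE iN0 mul0r ltxx.
  rewrite {2}expr2 {3}lE mulrCA ler_pdivlMl// mulr_sumr.
  rewrite mulr_natl -[X in _ *+ X]card_ord -sumr_const.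
  exact: ler_sum.
have : (lambda ^+ 2 - A ^- 2) <= (lambda ^+ 2) ^+ 2.
  rewrite -(sqr_sqrtr d0) lerXn2r ?nnegrE ?sqrtr_ge0//; exact: sqr_ge0.
rewrite invr_sqrA leNgt; move: (lambda ^+ 2) hlambda => x x2 H; apply/negP => xu.
have : 0 < ((1 + u) / 2 - x) * (x - (1 - u) / 2) by rewrite mulr_gt0//; lra.
by nra.
Qed.

(** The square of the right side is lambda^2 - (lambda sin alpha_j)^2 >= (1 + u)/2 - (1 - u^2)/4 =
    ((1 + u)/2)^2, and (1 + u)/2 = 1 - 2B. *)
Lemma lambda_cos_ge j : 1 - 2 * B_of A <= lambda * cos (alpha j).
Proof.
have [_ u1] := andP u_bounds.
have u0 : 0 <= u := sqrtr_ge0 _.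
have := sqr_lambda_sin j; rewrite invr_sqrA B_ofE => H.
have := sqr_lambda_ge; have := cos2Dsin2 (alpha j).
have := mulr_gt0 lambda_gt0 (cos_alpha_gt0 j).
move: (cos _) (sin _) H => c s H lc cs1 l2.
have : ((1 + u) / 2) ^+ 2 <= (lambda * c) ^+ 2.
  have -> : (lambda * c) ^+ 2 = lambda ^+ 2 - (lambda * s) ^+ 2.
    by rewrite !exprMn -[X in X - _]mulr1 -cs1; ring.
  by lra.
by rewrite ler_pXn2r ?nnegrE//; lra.
Qed.

(** The left side is |1 - zinf_jk|^2 = 2 (1 - cos (alpha_j - alpha_k)). Dividing the bound on
    (lambda sin alpha_i)^2 by lambda^2 gives sin^2 alpha_i <= 2B, hence cos (alpha_j - alpha_k) >=
    (1 - 2B) - 2B, and the left side is even at most 8B. *)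
Lemma sqr_chord_le j k :
  (1 - cos (alpha j - alpha k)) ^+ 2 + sin (alpha j - alpha k) ^+ 2
    <= (4 * Num.sqrt (B_of A)) ^+ 2.
Proof.
rewrite exprMn sqr_sqrtr ?(ltW B_of_gt0)//.
have [_ u1] := andP u_bounds.
have u0 : 0 <= u := sqrtr_ge0 _.
have sin2 i : sin (alpha i) ^+ 2 <= 2 * B_of A.
  have := sqr_lambda_sin i; rewrite invr_sqrA B_ofE exprMn.
  by have := sqr_lambda_ge; have := sqr_ge0 (sin (alpha i)); nra.
have H : 1 - 4 * B_of A <= cos (alpha j - alpha k).
  rewrite cosB; have := B_of_gt0.
  have := cos_alpha_gt0 j; have := cos_alpha_gt0 k.
  have := cos2Dsin2 (alpha j); have := cos2Dsin2 (alpha k).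
  have := sin2 j; have := sin2 k.
  have : 0 <= 1 - 2 * B_of A by rewrite B_ofE; lra.
  move: (B_of A) (cos (alpha j)) (cos (alpha k)) (sin (alpha j)) (sin (alpha k)).
  move=> B cj ck sj sk B1 sk2 sj2 ek ej ck0 cj0 B0.
  have : 1 - 2 * B <= cj * ck.
    have jk0 : 0 <= cj * ck := ltW (mulr_gt0 cj0 ck0).
    by rewrite -(ler_pXn2r (ltn0Sn 1)) ?nnegrE// exprMn; nra.
  by nra.
have := cos2Dsin2 (alpha j - alpha k).
by have := B_of_gt0; move: (cos _) (sin _) H => c s H B0 cs1; nra.
Qed.
End State.
End PhaseLocked.

(** * Decay of the Lyapunov functional *)

(** In each of the four triple sums one index is free, so each equals N times the double sum. *)
Lemma sum_neighbors (R : realType) (N : nat) (n : 'I_N -> 'I_N -> R) (q : R) :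
  \sum_(j < N) \sum_(k < N) \sum_(l < N)
    (q / 2 * (n j k + n j l) + q / 2 * (n j k + n l k)) =
  2 * N%:R * q * \sum_(j < N) \sum_(k < N) n j k.
Proof.
set E := \sum_(j < N) \sum_(k < N) n j k.
have E1 : \sum_(j < N) \sum_(k < N) \sum_(l < N) n j k = N%:R * E.
  rewrite mulr_sumr; apply: eq_bigr => j _; rewrite mulr_sumr.
  by apply: eq_bigr => k _; rewrite sumr_const card_ord mulr_natl.
have E2 : \sum_(j < N) \sum_(k < N) \sum_(l < N) n j l = N%:R * E.
  rewrite mulr_sumr; apply: eq_bigr => j _.
  by rewrite sumr_const card_ord mulr_natl.
have E3 : \sum_(j < N) \sum_(k < N) \sum_(l < N) n l k = N%:R * E.
  rewrite sumr_const card_ord mulr_natl; congr (_ *+ _).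
  exact: exchange_big.
transitivity (\sum_(j < N) \sum_(k < N) (q / 2 * (\sum_(l < N) n j k +
    \sum_(l < N) n j l + \sum_(l < N) n j k + \sum_(l < N) n l k))).
  apply: eq_bigr => j _; apply: eq_bigr => k _.
  by rewrite -!big_split /= mulr_sumr; apply: eq_bigr => l _; ring.
have -> : 2 * N%:R * q * E =
    q / 2 * (N%:R * E + N%:R * E + N%:R * E + N%:R * E) by field.
rewrite -{1}E1 -{1}E2 -{1}E1 -E3 -!big_split /= mulr_sumr.
by apply: eq_bigr => j _; rewrite -!big_split /= mulr_sumr.
Qed.

(** * Bounds on the linear and cubic interaction sums *)

Section Interaction.
Variables (R : realType) (N : nat) (f g : 'I_N -> 'I_N -> R).

Let n j k := f j k ^+ 2 + g j k ^+ 2.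
Let E := \sum_(j < N) \sum_(k < N) n j k.

(** Real form of Re (conj(a) b c) <= q (|a|^2 + |b|^2) / 2 for |c| <= q, obtained from |q a - b c|^2
    >= 0. *)
Lemma dot_mul_le (q a1 a2 b1 b2 c1 c2 : R) : 0 < q ->
  c1 ^+ 2 + c2 ^+ 2 <= q ^+ 2 ->
  a1 * (b1 * c1 - b2 * c2) + a2 * (b1 * c2 + b2 * c1) <=
  q / 2 * ((a1 ^+ 2 + a2 ^+ 2) + (b1 ^+ 2 + b2 ^+ 2)).
Proof.
move=> q0 cq.
rewrite -(ler_pM2l q0) -subr_ge0.
set d1 := b1 * c1 - b2 * c2; set d2 := b1 * c2 + b2 * c1.
have dE : d1 ^+ 2 + d2 ^+ 2 = (c1 ^+ 2 + c2 ^+ 2) * (b1 ^+ 2 + b2 ^+ 2).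
  by rewrite /d1 /d2; ring.
have H : d1 ^+ 2 + d2 ^+ 2 <= q ^+ 2 * (b1 ^+ 2 + b2 ^+ 2).
  by rewrite dE ler_wpM2r// addr_ge0// sqr_ge0.
have := sqr_ge0 (q * a1 - d1); have := sqr_ge0 (q * a2 - d2).
by move: d1 d2 H {dE} => d1 d2; nra.
Qed.

(** Each neighbour w_jl and w_lk is paired separately with w_jk, where w = f + i g; counting the
    squares that arise gives the factor 2N. *)
Lemma linear_interaction_le (q : R) (a b : 'I_N -> 'I_N -> R) : 0 < q ->
  (forall j k, a j k ^+ 2 + b j k ^+ 2 <= q ^+ 2) ->
  \sum_(j < N) \sum_(k < N)
    (f j k * ((\sum_(l < N) (f j l + f l k)) * a j k -
              (\sum_(l < N) (g j l + g l k)) * b j k) +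
     g j k * ((\sum_(l < N) (f j l + f l k)) * b j k +
              (\sum_(l < N) (g j l + g l k)) * a j k))
  <= 2 * N%:R * q * E.
Proof.
move=> q0 abq.
rewrite /E -(sum_neighbors n q).
apply: ler_sum => j _; apply: ler_sum => k _.
rewrite !mulr_suml -sumrB -big_split/= !mulr_sumr -big_split/=.
apply: ler_sum => l _.
have := lerD (dot_mul_le (f j k) (g j k) (f j l) (g j l) q0 (abq j k))
             (dot_mul_le (f j k) (g j k) (f l k) (g l k) q0 (abq j k)).
by apply: le_trans; rewrite le_eqVlt; apply/orP; left; apply/eqP; ring.
Qed.

(** Since Re (conj(w) W w) = Re(W) |w|^2, only the real parts [f] enter: 2N of them, each at most
    [m]. *)
Lemma cubic_interaction_le (m : R) : (forall j k, `|f j k| <= m) ->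
  \sum_(j < N) \sum_(k < N) (\sum_(l < N) (f j l + f l k)) * n j k
  <= 2 * N%:R * m * E.
Proof.
move=> fm; rewrite mulr_sumr; apply: ler_sum => j _.
rewrite mulr_sumr; apply: ler_sum => k _.
apply: ler_wpM2r; first by rewrite addr_ge0// sqr_ge0.
have -> : 2 * N%:R * m = \sum_(l < N) (m + m).
  by rewrite sumr_const card_ord -mulr_natl; ring.
by apply: ler_sum => l _; apply: lerD; exact: le_trans (ler_norm _) (fm _ _).
Qed.
End Interaction.

(** * The derivative of the squared deviation along solutions *)

Section Lyapunov.
Variables (R : realType) (N : nat).
Variables (kappa lambda : R) (Omega alpha : 'I_N -> R).
Variable z : 'I_N -> 'I_N -> R -> R[i].
Hypothesis kappa_gt0 : 0 < kappa.
Hypothesis hsys : correlation_system kappa Omega z.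
Hypothesis hlocked : phase_locked kappa Omega alpha lambda.

Let N_gt0 : 0 < N%:R :> R.
Proof.
have [_ /andP[lambda_gt0 _] _ lE _] := hlocked.
rewrite ltr0n lt0n; apply/eqP => N0.
(* The inverse of 0 is 0 by convention, so [N = 0] would force [lambda = 0]. *)
have iN0 : N%:R^-1 = 0 :> R by rewrite N0 invr0.
by move: lambda_gt0; rewrite lE iN0 mul0r ltxx.
Qed.

Local Notation f := (fdiff alpha z).
Local Notation g := (gdiff alpha z).

Definition deviation t := \sum_(j < N) \sum_(k < N) (f j k t ^+ 2 + g j k t ^+ 2).

Definition deviation_deriv t :=
  \sum_(j < N) \sum_(k < N)
    2 * (f j k t * - complex.Re (correlation_rhs kappa Omega z j k t) +
         g j k t * - complex.Im (correlation_rhs kappa Omega z j k t)).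

Lemma has_deriv_deviation t : 0 <= t ->
  has_deriv_ge0 deviation t (deviation_deriv t).
Proof.
move=> t0; apply: has_deriv_ge0_sum => j; apply: has_deriv_ge0_sum => k.
have [zRe zIm] := hsys j k t0.
have sqrB (x : R -> R) c l : has_deriv_ge0 x t l ->
    has_deriv_ge0 (fun s => (c - x s) ^+ 2) t (2 * ((c - x t) * - l)).
  move=> xl.
  have H : has_deriv_ge0 (fun s => c + -1 * x s) t (0 + (0 * x t + -1 * l)).
    apply: has_deriv_ge0D; first exact: has_deriv_ge0_cst.
    by apply: has_deriv_ge0M => //; exact: has_deriv_ge0_cst.
  have := has_deriv_ge0M H H.
  rewrite (_ : (fun s => _ * _) = fun s => (c - x s) ^+ 2); last first.
    by apply/funext => s; ring.
  by congr has_deriv_ge0; ring.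
rewrite mulrDr.
by apply: has_deriv_ge0D; exact: sqrB.
Qed.

Lemma lyapunovE t : lyapunov alpha z t = (2 * N%:R ^+ 2)^-1 * deviation t.
Proof. by []. Qed.

Let ReD (x y : R[i]) : complex.Re (x + y) = complex.Re x + complex.Re y.
Proof. by case: x y => [? ?] []. Qed.

Let ImD (x y : R[i]) : complex.Im (x + y) = complex.Im x + complex.Im y.
Proof. by case: x y => [? ?] []. Qed.

Let Re_sum (F : 'I_N -> R[i]) :
  complex.Re (\sum_(l < N) F l) = \sum_(l < N) complex.Re (F l).
Proof. by apply: (big_morph _ ReD). Qed.

Let Im_sum (F : 'I_N -> R[i]) :
  complex.Im (\sum_(l < N) F l) = \sum_(l < N) complex.Im (F l).
Proof. by apply: (big_morph _ ImD). Qed.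

Let ReM (x y : R[i]) : complex.Re (x * y) =
  complex.Re x * complex.Re y - complex.Im x * complex.Im y.
Proof. by case: x y => [? ?] []. Qed.

Let ImM (x y : R[i]) : complex.Im (x * y) =
  complex.Re x * complex.Im y + complex.Im x * complex.Re y.
Proof. by case: x y => [? ?] []. Qed.

(** In complex form, F + i G is W and a + i b is 1 - zinf. *)
Let F j k t := \sum_(l < N) (f j l t + f l k t).
Let G j k t := \sum_(l < N) (g j l t + g l k t).
Let a j k := 1 - cos (alpha j - alpha k).
Let b j k := - sin (alpha j - alpha k).

(** This is Re (conj(w) w') with w' = - z'. The rotation and Im Z act on w as imaginary factors and
    contribute nothing. *)
Lemma dissipation_identity j k t :
  f j k t * - complex.Re (correlation_rhs kappa Omega z j k t) +
  g j k t * - complex.Im (correlation_rhs kappa Omega z j k t) =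
  - (kappa / 2) * (lambda * cos (alpha j) + lambda * cos (alpha k)) *
    (f j k t ^+ 2 + g j k t ^+ 2) +
  kappa / (2 * N%:R) *
    ((f j k t * (F j k t * a j k - G j k t * b j k) +
      g j k t * (F j k t * b j k + G j k t * a j k)) +
     F j k t * (f j k t ^+ 2 + g j k t ^+ 2)).
Proof.
have N0 : N%:R != 0 :> R by rewrite gt_eqF.
have [_ _ lsin lE sin0] := hlocked.
have kn : kappa != 0 by rewrite gt_eqF.
have OE i : Omega i = kappa * (lambda * sin (alpha i)).
  by rewrite lsin; field.
pose c i := cos (alpha i); pose s i := sin (alpha i).
have sumc : \sum_(l < N) c l = N%:R * lambda by rewrite lE mulrA divff// mul1r.
have sums : \sum_(l < N) s l = 0.
  by move/eqP: sin0; rewrite mulf_eq0 invr_eq0 (negbTE N0) => /eqP.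
have xE i l : complex.Re (z i l t) = c i * c l + s i * s l - f i l t.
  by rewrite /fdiff /= cosB subKr.
have yE i l : complex.Im (z i l t) = s i * c l - c i * s l - g i l t.
  by rewrite /gdiff /= sinB subKr.
(* The addition formulas separate the index [l], and the means of cos and sin are lambda and 0; so
   the sum is Z - W, here its real part. *)
have SxE : \sum_(l < N) complex.Re (z j l t + z l k t) =
    N%:R * lambda * (c j + c k) - F j k t.
  transitivity (\sum_(l < N)
      ((c j + c k) * c l + (s j + s k) * s l - (f j l t + f l k t))).
    by apply: eq_bigr => l _; rewrite ReD !xE; ring.
  by rewrite sumrB big_split /= -!mulr_sumr sumc sums /F; ring.
have SyE : \sum_(l < N) complex.Im (z j l t + z l k t) =
    N%:R * lambda * (s j - s k) - G j k t.
  transitivity (\sum_(l < N)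
      ((s j - s k) * c l + (c k - c j) * s l - (g j l t + g l k t))).
    by apply: eq_bigr => l _; rewrite ImD !yE; ring.
  by rewrite sumrB big_split /= -!mulr_sumr sumc sums /G; ring.
have REq : complex.Re (correlation_rhs kappa Omega z j k t) =
    - (Omega j - Omega k) * complex.Im (z j k t) + kappa / (2 * N%:R) *
    ((N%:R * lambda * (c j + c k) - F j k t) * (1 - complex.Re (z j k t)) +
     (N%:R * lambda * (s j - s k) - G j k t) * complex.Im (z j k t)).
  rewrite -SxE -SyE /correlation_rhs -mulr_suml.
  move: (\sum_(l < N) (_ + _)) (Re_sum (fun l => z j l t + z l k t))
    (Im_sum (fun l => z j l t + z l k t)).
  move=> S <- <-; rewrite ReD !ReM !ImM /=.
  by case: (z j k t) => ? ? /=; ring.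
have IEq : complex.Im (correlation_rhs kappa Omega z j k t) =
    (Omega j - Omega k) * complex.Re (z j k t) + kappa / (2 * N%:R) *
    (- (N%:R * lambda * (c j + c k) - F j k t) * complex.Im (z j k t) +
     (N%:R * lambda * (s j - s k) - G j k t) * (1 - complex.Re (z j k t))).
  rewrite -SxE -SyE /correlation_rhs -mulr_suml.
  move: (\sum_(l < N) (_ + _)) (Re_sum (fun l => z j l t + z l k t))
    (Im_sum (fun l => z j l t + z l k t)).
  move=> S <- <-; rewrite ImD !ImM !ReM /=.
  by case: (z j k t) => ? ? /=; ring.
rewrite REq IEq !xE !yE !OE /a /b cosB sinB -/(c j) -/(c k) -/(s j) -/(s k).
have cs i : c i ^+ 2 = 1 - s i ^+ 2 by exact: cos2sin2.
(* These two identities express that zinf is stationary. *)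
have e1 : (s j - s k) * (s j * c k - c j * s k) =
    (c j + c k) * (1 - (c j * c k + s j * s k)).
  have := cs j; have := cs k; move: (c j) (c k) (s j) (s k).
  by move=> ? ? ? ? h1 h2; ring: h1 h2.
have e2 : (s j - s k) * (1 + (c j * c k + s j * s k)) =
    (c j + c k) * (s j * c k - c j * s k).
  have := cs j; have := cs k; move: (c j) (c k) (s j) (s k).
  by move=> ? ? ? ? h1 h2; ring: h1 h2.
move: (f j k t) (g j k t) (F j k t) (G j k t) => f0 g0 F0 G0.
(* Trading kappa for K removes all divisions. The stationarity identities, weighted by [f0] and
   [g0], then leave a linear consequence. *)
have [K KE kE] : exists2 K, kappa / (2 * N%:R) = K & kappa = 2 * N%:R * K.
  by exists (kappa / (2 * N%:R)) => //; field.
rewrite KE kE.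
move: (N%:R : R) (c j) (c k) (s j) (s k) e1 e2 => n cj ck sj sk e1 e2.
have h1 := congr1 (fun v => f0 * (K * n * lambda) * v) e1.
have h2 := congr1 (fun v => g0 * (K * n * lambda) * v) e2.
by move: h1 h2 => /=; lra.
Qed.
Lemma deviation_ge0 t : 0 <= deviation t.
Proof.
by apply: sumr_ge0 => j _; apply: sumr_ge0 => k _; rewrite addr_ge0 ?sqr_ge0.
Qed.

Lemma le_deviation j k t : f j k t ^+ 2 + g j k t ^+ 2 <= deviation t.
Proof.
rewrite /deviation (bigD1 j)//= (bigD1 k)//= -addrA lerDl.
by rewrite addr_ge0 ?sumr_ge0// => i _; rewrite ?sumr_ge0// => *;
  rewrite addr_ge0 ?sqr_ge0.
Qed.

(** Sum of the pointwise identity: [p] bounds the dissipation from below, [q] bounds |1 - zinf|, and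
    [m] bounds every |f_jk| because one square is at most the deviation. *)
Lemma deviation_deriv_le (p q m t : R) : 0 < q -> 0 <= m ->
  (forall j, p <= lambda * cos (alpha j)) ->
  (forall j k, (1 - cos (alpha j - alpha k)) ^+ 2 + sin (alpha j - alpha k) ^+ 2
     <= q ^+ 2) ->
  deviation t <= m ^+ 2 ->
  deviation_deriv t <= - (2 * kappa * (p - q - m)) * deviation t.
Proof.
move=> q0 m0 hp hq Em.
have n0 j k : 0 <= f j k t ^+ 2 + g j k t ^+ 2 by rewrite addr_ge0 ?sqr_ge0.
have fm j k : `|f j k t| <= m.
  rewrite -(ler_pXn2r (ltn0Sn 1)) ?nnegrE// real_normK ?num_real//.
  by apply: le_trans Em; apply: le_trans (le_deviation j k t); rewrite lerDl sqr_ge0.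
have cub := @cubic_interaction_le R N (fun j k => f j k t)
  (fun j k => g j k t) m fm.
have abq j k : a j k ^+ 2 + b j k ^+ 2 <= q ^+ 2 by rewrite /b sqrrN; exact: hq.
have {abq}lin := @linear_interaction_le R N (fun j k => f j k t)
  (fun j k => g j k t) q a b q0 abq.
have K0 : 0 <= kappa / (2 * N%:R) by rewrite divr_ge0 ?mulr_ge0 ?ltW.
have := lerD (ler_wpM2l K0 lin) (ler_wpM2l K0 cub).
rewrite -mulrDr -big_split/=.
under eq_bigr do rewrite -big_split/=.
rewrite -/(deviation t) => H.
have -> : - (2 * kappa * (p - q - m)) * deviation t =
   2 * (- (kappa * p) * deviation t +
     (kappa / (2 * N%:R) * (2 * N%:R * q * deviation t) +
     kappa / (2 * N%:R) * (2 * N%:R * m * deviation t))).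
  by field; rewrite gt_eqF.
rewrite /deviation_deriv.
under eq_bigr do rewrite -mulr_sumr.
rewrite -mulr_sumr ler_pM2l//.
apply: le_trans (lerD (lexx _) H).
rewrite mulr_sumr mulr_sumr -big_split/=; apply: ler_sum => j _.
rewrite !mulr_sumr -big_split/=; apply: ler_sum => k _.
rewrite dissipation_identity lerD2r; apply: ler_wpM2r => //.
have := ler_wpM2l (ltW kappa_gt0) (lerD (hp j) (hp k)); lra.
Qed.
End Lyapunov.

(** * Trapping the deviation, choice of the rate, and exponential convergence *)

Theorem theorem4p1 (R : realType) (A : R) (hA : A_min R < A) :
  0 < C1_of A /\
  exists C2 : R -> nat -> R -> R -> R,
  forall (N : nat) (kappa : R) (Omega : 'I_N -> R)
         (z : 'I_N -> 'I_N -> R -> R[i]) (alpha : 'I_N -> R) (lambda : R),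
    (2 <= N)%N ->
    0 < kappa ->
    \sum_(j < N) Omega j = 0 ->
    is_correlation z ->
    correlation_system kappa Omega z ->
    A_min R * max_freq Omega < kappa ->
    A * max_freq Omega <= kappa ->
    phase_locked kappa Omega alpha lambda ->
    (forall j, - (pi / 2) < alpha j < pi / 2) ->
    (* selects the stable branch of the equations for lambda, alpha: without it
       the conclusion fails, e.g. for N = 2, Omega = (7/50, - 7/50), kappa = 1,
       A = 50/7, lambda = cos (alpha 0) = sqrt (1/50), alpha 1 = - alpha 0 *)
    1 / 2 <= lambda ^+ 2 ->
    let M1 := supf0 alpha z in
    let M2 := supg0 alpha z in
    4 * N%:R * (M1 + M2) - 2 * M1 < C1_of A ->
    [/\ 0 < C2 kappa N M1 M2,
        converges_exponentially z (zinf alpha)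
      & forall t, 0 <= t ->
          exists2 dL, has_deriv_ge0 (lyapunov alpha z) t dL &
            dL <= - C2 kappa N M1 M2 * lyapunov alpha z t].
Proof.
split; first exact: C1_of_gt0.
exists (fun kappa N M1 M2 => kappa * (C1_of A - 2 * (N%:R * (M1 + M2)))).
move=> N kappa Omega z alpha lambda N2 k0 _ _ hsys _ hfreq hlocked halpha hl.
move=> M1 M2 hM.
have B0 := B_of_gt0 hA.
have q0 : 0 < 4 * Num.sqrt (B_of A) by rewrite mulr_gt0// sqrtr_gt0.
have M1_ge j k : `|fdiff alpha z j k 0| <= M1 by exact: (le_bigmax _ _ (j, k)).
have M2_ge j k : `|gdiff alpha z j k 0| <= M2 by exact: (le_bigmax _ _ (j, k)).
have M1_ge0 : 0 <= M1 by exact: bigmax_ge_id.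
have M2_ge0 : 0 <= M2 by exact: bigmax_ge_id.
pose m := N%:R * (M1 + M2).
have m_ge0 : 0 <= m by rewrite mulr_ge0// addr_ge0.
(* The smallness assumption exceeds 2m by 2N (M1 + M2) - 2 M1 >= 0 on its left side. *)
have mC : 2 * m < C1_of A.
  apply: le_lt_trans hM; rewrite /m.
  have : 2 <= N%:R :> R by rewrite ler_nat.
  by nra.
have E0 : deviation alpha z 0 <= m ^+ 2.
  have -> : m ^+ 2 = \sum_(j < N) \sum_(k < N) (M1 + M2) ^+ 2.
    by rewrite !sumr_const card_ord -mulrnA -mulr_natl natrM /m; ring.
  apply: ler_sum => j _; apply: ler_sum => k _.
  have : `|fdiff alpha z j k 0| ^+ 2 <= M1 ^+ 2 by rewrite lerXn2r ?nnegrE.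
  have : `|gdiff alpha z j k 0| ^+ 2 <= M2 ^+ 2 by rewrite lerXn2r ?nnegrE.
  by rewrite !real_normK ?num_real//; have := mulr_ge0 M1_ge0 M2_ge0; nra.
have dE := has_deriv_deviation (alpha := alpha) hsys.
pose dev := deviation alpha z; pose ddev := deviation_deriv kappa Omega alpha z.
(* The radius [r] stays free: r = C1/2 gives rate 0, enough for trapping and monotonicity; r = m
   then gives the positive rate. The bound uses 2 (1 - 2B - 4 sqrt B) = C1 + 4B >= C1. *)
have decay r t : 0 <= r -> dev t <= r ^+ 2 ->
    ddev t <= - (kappa * (C1_of A - 2 * r)) * dev t.
  move=> r0 Er.
  have := deviation_deriv_le k0 hlocked q0 r0
    (lambda_cos_ge hA k0 hfreq hlocked halpha hl)
    (sqr_chord_le hA k0 hfreq hlocked halpha hl) Er.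
  move=> /le_trans; apply; apply: ler_wpM2r; first exact: deviation_ge0.
  rewrite lerN2 -mulrA [leRHS]mulrCA; apply: ler_wpM2l; first exact: ltW.
  by rewrite /C1_of; lra.
have C0 : 0 <= C1_of A / 2 by rewrite divr_ge0// ltW// C1_of_gt0.
have CE : C1_of A - 2 * (C1_of A / 2) = 0 by field.
have dev_lt t : 0 <= t -> dev t < (C1_of A / 2) ^+ 2.
  apply: (barrier_ge0 dE) => [x x0 Ex|].
    by apply: le_trans (decay _ _ C0 Ex) _; rewrite CE mulr0 oppr0 mul0r.
  by apply: le_lt_trans E0 _; rewrite ltr_pXn2r//; lra.
have dev_le t : 0 <= t -> dev t <= m ^+ 2.
  move=> t0; apply: le_trans E0.
  apply: (has_deriv_ge0_nonincreasing _ dE) => [|x /andP[/ltW x0 _]].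
    by rewrite lexx.
  apply: le_trans (decay _ _ C0 (ltW (dev_lt x x0))) _.
  by rewrite CE mulr0 oppr0 mul0r.
rewrite -/m; set c := kappa * _.
have c0 : 0 < c by rewrite mulr_gt0// subr_gt0.
have ddev_le t : 0 <= t -> ddev t <= - c * dev t.
  by move=> t0; apply: decay => //; exact: dev_le.
split=> //.
(* The rate is halved since |w_jk| is at most the square root of the deviation; adding 1 keeps the
   constant positive when the initial deviation vanishes. *)
- exists (Num.sqrt (dev 0) + 1), (c / 2); split; first last.
  + move=> j k t t0; rewrite normc_def lecR.
    have := gronwall_ge0 dE ddev_le t0.
    have [-> ->] : complex.Re (z j k t - zinf alpha j k) = - fdiff alpha z j k t /\
        complex.Im (z j k t - zinf alpha j k) = - gdiff alpha z j k t.
      by rewrite /fdiff /gdiff; case: (z j k t) => x y /=; rewrite !opprB.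
    rewrite !sqrrN => Et.
    apply: (@le_trans _ _ (Num.sqrt (dev 0 * expR (- c * t)))).
      by rewrite ler_wsqrtr// (le_trans (le_deviation alpha z j k t)).
    rewrite sqrtrM ?deviation_ge0//.
    have -> : Num.sqrt (expR (- c * t)) = expR (- (c / 2) * t).
      have -> : expR (- c * t) = expR (- (c / 2) * t) ^+ 2.
        by rewrite -expRM_natl; congr expR; field.
      by rewrite sqrtr_sqr ger0_norm// expR_ge0.
    by rewrite ler_wpM2r ?expR_ge0// lerDl.
  + exact: divr_gt0.
  + by rewrite ltr_wpDl// sqrtr_ge0.
- move=> t t0; exists ((2 * N%:R ^+ 2)^-1 * ddev t); last first.
    rewrite lyapunovE [leRHS]mulrCA; apply: ler_wpM2l; last exact: ddev_le.
    by rewrite invr_ge0 mulr_ge0.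
  have := has_deriv_ge0M (has_deriv_ge0_cst (2 * N%:R ^+ 2)^-1 t) (dE t t0).
  by rewrite mul0r add0r.
Qed.
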